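(* Let $n$ be an integer greater than $1$. If $f\colon\mathbb{N}^2\to\mathbb{N}$ is a base-$n$ discrete space-filling curve, then $f$ is a base-$n$ perfect pairing function.
   Context: $\mathbb{N}$ denotes the non-negative integers. $S_N$ is the set of permutations (bijections) of $\{0,1,\ldots,N-1\}$; $\circ$ is composition, $\sigma^k$ is the $k$-fold composite of $\sigma$ (identity for $k=0$), and $\sigma^{-k}=(\sigma^{-1})^k$. For $x\in\mathbb{N}$, $\operatorname{len}_n(x)=\lceil\log_n(x+1)\rceil$. A function $f\colon\mathbb{N}^2\to\mathbb{N}$ is a base-$n$ discrete space-filling curve if there exist permutations $\tau,\sigma_0,\sigma_1,\ldots,\sigma_{n^2-1}\in S_{n^2}$ such that: (a) $\tau(0)=0$ and $\sigma_0(0)=0$; (b) $f(0,0)=0$; (c) for all $x,y,z\in\mathbb{N}$ with $(x,y)\ne(0,0)$, $f(x,y)=z$ if and only if, writing $m=\max(\operatorname{len}_n(x),\operatorname{len}_n(y))$, $x=\sum_{i=0}^{m-1}x_in^i$ and $y=\sum_{i=0}^{m-1}y_in^i$ (base-$n$ digits $x_i,y_i\in\{0,\ldots,n-1\}$), and $z=\sum_{i=0}^{m-1}z_i(n^2)^i$ with $z_i\in\{0,\ldots,n^2-1\}$ (a base-$n^2$ expansion of $z$ with $m$ digits), one has $z_{m-1}=\sigma_0^{-(m-1)}\circ\tau(nx_{m-1}+y_{m-1})$ and, for each $j=m-2,m-3,\ldots,0$, $z_j=\sigma_{z_{j+1}}\circ\sigma_{z_{j+2}}\circ\cdots\circ\sigma_{z_{m-1}}\circ\sigma_0^{-(m-1)}\circ\tau(nx_j+y_j)$.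 A pairing function is a bijection $\mathbb{N}^2\to\mathbb{N}$; it is base-$n$ perfect if for all $x,y,k\in\mathbb{N}$ with $\operatorname{len}_n(x)\le k$ and $\operatorname{len}_n(y)\le k$ one has $\operatorname{len}_n(f(x,y))\le 2k$. *)

(* Defs.v *)
From mathcomp Require Import all_boot all_fingroup.

Set Implicit Arguments.
Unset Strict Implicit.
Unset Printing Implicit Defensive.

(* [up_log n k] is the least e such that k <= n ^ e, that is, the ceiling of
   log_n k, for n > 1 and k > 0. *)
Definition len (n x : nat) : nat := up_log n x.+1.

Lemma digit0_proof (n : nat) : 1 < n -> 0 < n ^ 2.
Proof. by move=> n_gt1; rewrite expn_gt0 (ltnW n_gt1). Qed.

Definition digit0 (n : nat) (n_gt1 : 1 < n) : 'I_(n ^ 2) :=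
  Ordinal (digit0_proof n_gt1).

Lemma digit_pair_proof (n : nat) (a b : 'I_n) : n * a + b < n ^ 2.
Proof.
rewrite -mulnn; apply: (@leq_trans (n * a.+1)).
  by rewrite mulnS [n + _]addnC ltn_add2l.
by rewrite leq_mul2l ltn_ord orbT.
Qed.

Definition digit_pair (n : nat) (a b : 'I_n) : 'I_(n ^ 2) :=
  Ordinal (digit_pair_proof a b).

(* The product of permutations in MathComp applies its left factor first, so
   the composites below are composites of the underlying functions, with the
   rightmost function applied first. Digits are indexed by nat, and only those
   of index less than m matter. *)
Definition curve_digits (n : nat) (n_gt1 : 1 < n) (tau : 'S_(n ^ 2))
    (sigma : 'I_(n ^ 2) -> 'S_(n ^ 2)) (m : nat)
    (xd yd : nat -> 'I_n) (zd : nat -> 'I_(n ^ 2)) : Prop :=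
  let sigma0V := ((sigma (digit0 n_gt1))^-1 ^+ m.-1)%g in
  zd m.-1 = (sigma0V \o tau) (digit_pair (xd m.-1) (yd m.-1)) /\
  forall j : nat, j < m.-1 ->
    zd j = ((\big[(fun g h => g \o h)/id]_(j.+1 <= i < m)
               (fun u : 'I_(n ^ 2) => sigma (zd i) u))
            \o sigma0V \o tau) (digit_pair (xd j) (yd j)).

Definition discrete_space_filling_curve (n : nat) (n_gt1 : 1 < n)
    (f : nat * nat -> nat) : Prop :=
  exists (tau : 'S_(n ^ 2)) (sigma : 'I_(n ^ 2) -> 'S_(n ^ 2)),
    [/\ tau (digit0 n_gt1) = digit0 n_gt1,
        sigma (digit0 n_gt1) (digit0 n_gt1) = digit0 n_gt1,
        f (0, 0) = 0
      & forall x y z : nat, (x, y) <> (0, 0) ->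
          let m := maxn (len n x) (len n y) in
          f (x, y) = z <->
          exists (xd yd : nat -> 'I_n) (zd : nat -> 'I_(n ^ 2)),
            [/\ x = \sum_(i < m) xd i * n ^ i,
                y = \sum_(i < m) yd i * n ^ i,
                z = \sum_(i < m) zd i * (n ^ 2) ^ i
              & curve_digits n_gt1 tau sigma m xd yd zd]].

Definition pairing_function (f : nat * nat -> nat) : Prop := bijective f.

Definition perfect_pairing_function (n : nat) (f : nat * nat -> nat) : Prop :=
  pairing_function f /\
  forall x y k : nat, len n x <= k -> len n y <= k -> len n (f (x, y)) <= 2 * k.

(* Main.v *)
(* If an m-digit triple (x, y, z) satisfies the digit recursion, then so does
   the triple padded with a leading zero: the new top digit of z is 0 because
   tau and sigma_0 fix 0, and the new factor sigma_0 cancels one of the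
   sigma_0^-1. Hence one digit length can be used for finitely many points at
   once. At a fixed length the recursion reads z_j = P_j (n x_j + y_j), where
   the permutation P_j depends only on the higher digits of z; solved from the
   top digit down it determines z from (x, y), and it also determines (x, y)
   from z. *)
Require Import Defs.
From mathcomp Require Import all_boot all_fingroup.

Set Implicit Arguments.
Unset Strict Implicit.

Lemma digit_sum_lt (b m : nat) (d : nat -> 'I_b) :
  \sum_(i < m) d i * b ^ i < b ^ m.
Proof.
elim: m => [|m IHm]; first by rewrite big_ord0.
rewrite big_ord_recr /= expnS.
apply: (@leq_trans (b ^ m + d m * b ^ m)); first by rewrite ltn_add2r.
by rewrite -mulSn leq_mul2r ltn_ord orbT.
Qed.

Lemma digit_sum_inj (b m : nat) (d e : nat -> 'I_b) :
  \sum_(i < m) d i * b ^ i = \sum_(i < m) e i * b ^ i ->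
  forall i, i < m -> d i = e i.
Proof.
elim: m => [//|m IHm]; rewrite !big_ord_recr /= => eq_de.
have bm_gt0 : 0 < b ^ m by rewrite expn_gt0 (leq_ltn_trans _ (ltn_ord (d 0))).
have mod_sum (c : nat -> 'I_b) :
    (\sum_(i < m) c i * b ^ i + c m * b ^ m) %% b ^ m = \sum_(i < m) c i * b ^ i.
  by rewrite addnC modnMDl modn_small ?digit_sum_lt.
have div_sum (c : nat -> 'I_b) :
    (\sum_(i < m) c i * b ^ i + c m * b ^ m) %/ b ^ m = c m.
  by rewrite addnC divnMDl // divn_small ?digit_sum_lt ?addn0.
have low : \sum_(i < m) d i * b ^ i = \sum_(i < m) e i * b ^ i.
  by rewrite -mod_sum eq_de mod_sum.
move=> i; rewrite ltnS leq_eqVlt => /predU1P[->|]; last exact: IHm.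
by apply: val_inj; rewrite /= -div_sum eq_de div_sum.
Qed.

Lemma digit_sum_exists (b m x : nat) : 0 < b -> x < b ^ m ->
  exists d : nat -> 'I_b, x = \sum_(i < m) d i * b ^ i.
Proof.
move=> b_gt0; elim: m x => [|m IHm] x ltx.
  by exists (fun=> Ordinal b_gt0); rewrite big_ord0; case: x ltx.
have bm_gt0 : 0 < b ^ m by rewrite expn_gt0 b_gt0.
have [d def_d] := IHm _ (ltn_pmod x bm_gt0).
have lt_top : x %/ b ^ m < b by rewrite ltn_divLR // -expnS.
exists (fun i => if i == m then Ordinal lt_top else d i).
rewrite big_ord_recr /= eqxx /= [LHS](divn_eq x (b ^ m)) addnC def_d.
by congr (_ + _); apply: eq_bigr => i _; rewrite (ltn_eqF (ltn_ord i)).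
Qed.

Lemma digit_pair_inj (n : nat) (a b c d : 'I_n) :
  digit_pair a b = digit_pair c d -> a = c /\ b = d.
Proof.
move=> /(congr1 val) /= eq_ac.
have n_gt0 : 0 < n by apply: leq_ltn_trans (ltn_ord a).
split; apply: val_inj => /=.
  move: (congr1 (divn^~ n) eq_ac).
  by rewrite ![n * _]mulnC !divnMDl // !divn_small // !addn0.
move: (congr1 (modn^~ n) eq_ac).
by rewrite ![n * _]mulnC !modnMDl !modn_small.
Qed.

(** Quotient and remainder of [u] by [n]. The boolean equality lets [xchoose] pick the two digits in
    [curve_at_surj]. *)
Lemma digit_pair_surj (n : nat) (u : 'I_(n ^ 2)) :
  exists ab : 'I_n * 'I_n, digit_pair ab.1 ab.2 == u.
Proof.
have n_gt0 : 0 < n by case: n u => [[]|].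
have ltq : u %/ n < n by rewrite ltn_divLR // mulnn.
exists (Ordinal ltq, Ordinal (ltn_pmod u n_gt0)).
by apply/eqP/val_inj; rewrite /= mulnC -divn_eq.
Qed.

Lemma len_leq (n x k : nat) : 1 < n -> (len n x <= k) = (x < n ^ k).
Proof.
move=> n_gt1; apply/idP/idP => [le_k|]; last exact: up_log_min.
by apply: leq_trans (up_logP x.+1 n_gt1) _; rewrite leq_exp2l.
Qed.

(** The permutation P_j of the overview. Products of permutations apply the left factor first, so
    the list is reversed to let the top digit of z act before the lower ones. *)
Definition curve_perm (n : nat) (n_gt1 : 1 < n) (tau : 'S_(n ^ 2))
    (sigma : 'I_(n ^ 2) -> 'S_(n ^ 2)) (m : nat)
    (zd : nat -> 'I_(n ^ 2)) (j : nat) : 'S_(n ^ 2) :=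
  (tau * (sigma (digit0 n_gt1))^-1 ^+ m.-1
     * \prod_(i <- rev (index_iota j.+1 m)) sigma (zd i))%g.

Lemma big_comp_perm (T : finType) (I : Type) (r : seq I) (s : I -> {perm T})
    (u : T) :
  (\big[(fun g h => g \o h)/id]_(i <- r) (fun v : T => s i v)) u
    = (\prod_(i <- rev r) s i)%g u.
Proof.
elim: r u => [|i r IHr] u; first by rewrite !big_nil perm1.
by rewrite rev_cons -cats1 big_cat big_seq1 big_cons permM /= IHr.
Qed.

(** For the top digit the product in [curve_perm] is empty, so the two clauses of [curve_digits]
    become one. The length is a successor because at length 0 [curve_digits] would still constrain
    [zd 0]. *)
Lemma curve_digitsP (n : nat) (n_gt1 : 1 < n) (tau : 'S_(n ^ 2))
    (sigma : 'I_(n ^ 2) -> 'S_(n ^ 2)) (m : nat)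
    (xd yd : nat -> 'I_n) (zd : nat -> 'I_(n ^ 2)) :
  curve_digits n_gt1 tau sigma m.+1 xd yd zd <->
  forall j, j < m.+1 ->
    zd j = curve_perm n_gt1 tau sigma m.+1 zd j (digit_pair (xd j) (yd j)).
Proof.
split=> [[/= top low] j|digitE].
  rewrite ltnS leq_eqVlt => /predU1P[->|/low ->].
    by rewrite top /curve_perm /index_iota subnn big_nil mulg1 permM.
  by rewrite /= big_comp_perm /curve_perm !permM.
split=> /= [|j lt_jm].
  by rewrite {1}digitE // /curve_perm /index_iota subnn big_nil mulg1 permM.
by rewrite big_comp_perm {1}digitE ?ltnS 1?ltnW // /curve_perm !permM.
Qed.

Lemma eq_curve_perm (n : nat) (n_gt1 : 1 < n) (tau : 'S_(n ^ 2))
    (sigma : 'I_(n ^ 2) -> 'S_(n ^ 2)) (m : nat)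
    (zd ze : nat -> 'I_(n ^ 2)) (j : nat) :
  (forall i, j < i < m -> zd i = ze i) ->
  curve_perm n_gt1 tau sigma m zd j = curve_perm n_gt1 tau sigma m ze j.
Proof.
move=> eq_z; congr (_ * _)%g; apply: eq_big_seq => i.
by rewrite mem_rev mem_index_iota => /eq_z ->.
Qed.

(** After the reversal, the factor sigma_0 of the new top digit stands first in the product, right
    after the powers of sigma_0^-1, and cancels the additional one. *)
Lemma curve_perm_pad (n : nat) (n_gt1 : 1 < n) (tau : 'S_(n ^ 2))
    (sigma : 'I_(n ^ 2) -> 'S_(n ^ 2)) (m : nat)
    (zd : nat -> 'I_(n ^ 2)) (j : nat) :
  j < m.+1 -> zd m.+1 = digit0 n_gt1 ->
  curve_perm n_gt1 tau sigma m.+2 zd j = curve_perm n_gt1 tau sigma m.+1 zd j.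
Proof.
move=> lt_jm z_top; rewrite /curve_perm /index_iota subSn // -[(_ - _).+1]addn1 iotaD.
rewrite subnKC // rev_cat big_cat big_seq1 z_top /= expgSr -!mulgA.
by rewrite mulKg.
Qed.

(** The length [m] is a free parameter here, no longer tied to x and y, so that points of different
    lengths can be compared. *)
Definition curve_at (n : nat) (n_gt1 : 1 < n) (tau : 'S_(n ^ 2))
    (sigma : 'I_(n ^ 2) -> 'S_(n ^ 2)) (m x y z : nat) : Prop :=
  exists (xd yd : nat -> 'I_n) (zd : nat -> 'I_(n ^ 2)),
    [/\ x = \sum_(i < m) xd i * n ^ i,
        y = \sum_(i < m) yd i * n ^ i,
        z = \sum_(i < m) zd i * (n ^ 2) ^ i
      & curve_digits n_gt1 tau sigma m xd yd zd].

Lemma digit_sum_pad (b m : nat) (d : nat -> 'I_b) (c : 'I_b) : c = 0 :> nat ->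
  \sum_(i < m.+1) (if i == m :> nat then c else d i) * b ^ i
    = \sum_(i < m) d i * b ^ i.
Proof.
move=> c0; rewrite big_ord_recr /= eqxx c0 addn0.
by apply: eq_bigr => i _; rewrite (ltn_eqF (ltn_ord i)).
Qed.

Section CurveAt.

Context (n : nat) (n_gt1 : 1 < n) (tau : 'S_(n ^ 2)).
Context (sigma : 'I_(n ^ 2) -> 'S_(n ^ 2)).
Context (tau0 : tau (digit0 n_gt1) = digit0 n_gt1).
Context (sigma0 : sigma (digit0 n_gt1) (digit0 n_gt1) = digit0 n_gt1).

Let zero : 'I_n := Ordinal (ltnW n_gt1).

Lemma digit_pair_zero : digit_pair zero zero = digit0 n_gt1.
Proof. by apply: val_inj; rewrite /= muln0. Qed.

Lemma sigma0V_fix k :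
  ((sigma (digit0 n_gt1))^-1 ^+ k)%g (digit0 n_gt1) = digit0 n_gt1.
Proof.
elim: k => [|k IHk]; first by rewrite perm1.
by rewrite expgSr permM IHk; apply: (canLR (permK _)); rewrite sigma0.
Qed.

Lemma curve_at_zero : curve_at n_gt1 tau sigma 1 0 0 0.
Proof.
exists (fun=> zero), (fun=> zero), (fun=> digit0 n_gt1).
split; rewrite ?big_ord1 //; split=> //=.
by rewrite digit_pair_zero tau0 perm1.
Qed.

Lemma curve_at_pad m x y z :
  curve_at n_gt1 tau sigma m.+1 x y z -> curve_at n_gt1 tau sigma m.+2 x y z.
Proof.
move=> [xd [yd [zd [-> -> -> /curve_digitsP digitE]]]].
pose ext T (c : T) (d : nat -> T) i := if i == m.+1 then c else d i.
exists (ext _ zero xd), (ext _ zero yd), (ext _ (digit0 n_gt1) zd).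
split; rewrite ?digit_sum_pad //; apply/curve_digitsP => j.
rewrite ltnS leq_eqVlt => /predU1P[->|lt_jm].
  rewrite /curve_perm /index_iota subnn big_nil mulg1 permM /ext eqxx.
  by rewrite digit_pair_zero tau0 sigma0V_fix.
rewrite curve_perm_pad /ext ?eqxx // (ltn_eqF lt_jm) {1}digitE //.
congr (fun_of_perm _ _); apply: eq_curve_perm => i /andP[_ lt_im].
by rewrite (ltn_eqF lt_im).
Qed.

Lemma curve_at_leq m k x y z : 0 < m <= k ->
  curve_at n_gt1 tau sigma m x y z -> curve_at n_gt1 tau sigma k x y z.
Proof.
case: m => //= m /subnKC <- at_m; elim: (k - m.+1) => [|d IHd].
  by rewrite addn0.
by rewrite addnS; exact: curve_at_pad.
Qed.

Lemma curve_at_fun m x y z w :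
  curve_at n_gt1 tau sigma m.+1 x y z -> curve_at n_gt1 tau sigma m.+1 x y w ->
  z = w.
Proof.
move=> [xd [yd [zd [-> -> -> /curve_digitsP zE]]]].
move=> [xe [ye [we [eq_x eq_y -> /curve_digitsP wE]]]].
(* Induction on the distance from [j] to the top position [m]: once all higher digits agree, both
   sides apply the same P_j to the same digit pair. *)
have eq_zw d j : m - j < d -> j < m.+1 -> zd j = we j.
  elim: d j => // d IHd j lt_d lt_j; rewrite zE // wE //.
  rewrite (digit_sum_inj eq_x) // (digit_sum_inj eq_y) //.
  congr (fun_of_perm _ _); apply: eq_curve_perm => i /andP[lt_ji lt_i].
  by apply: IHd => //; rewrite -ltnS (leq_trans _ lt_d) //
    ltnS ltn_sub2l // (leq_trans lt_ji).
by apply: eq_bigr => i _; rewrite (eq_zw (m - i).+1).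
Qed.

(** A common z fixes all its digits at once, so both points share every P_j, and injectivity of P_j
    recovers the digit pairs. *)
Lemma curve_at_inj m x y u v z :
  curve_at n_gt1 tau sigma m.+1 x y z -> curve_at n_gt1 tau sigma m.+1 u v z ->
  (x, y) = (u, v).
Proof.
move=> [xd [yd [zd [-> -> -> /curve_digitsP zE]]]].
move=> [ud [vd [we [-> -> eq_z /curve_digitsP wE]]]].
have {}eq_z := digit_sum_inj eq_z.
have eq_d j : j < m.+1 -> xd j = ud j /\ yd j = vd j.
  move=> lt_j; apply/digit_pair_inj.
  apply: (@perm_inj _ (curve_perm n_gt1 tau sigma m.+1 zd j)).
  rewrite -zE // eq_z // wE //; congr (fun_of_perm _ _).
  by apply: eq_curve_perm => i /andP[_ /eq_z].
by congr (_, _); apply: eq_bigr => i _;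
  case: (eq_d i (ltn_ord i)) => eq_x eq_y; rewrite ?eq_x ?eq_y.
Qed.

(** With the digits of z given, every P_j is known, and each digit pair is found separately by
    applying the inverse of P_j to z_j. *)
Lemma curve_at_surj m z : z < (n ^ 2) ^ m.+1 ->
  exists x y, [/\ x < n ^ m.+1, y < n ^ m.+1
                & curve_at n_gt1 tau sigma m.+1 x y z].
Proof.
move=> /digit_sum_exists[|zd ->]; first exact: ltn_ord (digit0 n_gt1).
pose u j := ((curve_perm n_gt1 tau sigma m.+1 zd j)^-1 (zd j))%g.
pose ab j := xchoose (digit_pair_surj (u j)).
exists (\sum_(i < m.+1) (ab i).1 * n ^ i), (\sum_(i < m.+1) (ab i).2 * n ^ i).
split; [exact: (digit_sum_lt _ (fun i => (ab i).1)) |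
        exact: (digit_sum_lt _ (fun i => (ab i).2)) |].
exists (fun i => (ab i).1), (fun i => (ab i).2), zd; split=> //.
apply/curve_digitsP => j _.
by rewrite (eqP (xchooseP (digit_pair_surj (u j)))) permKV.
Qed.

Lemma curve_at_lt m x y z : curve_at n_gt1 tau sigma m x y z -> z < n ^ (2 * m).
Proof. by case=> xd [yd [zd [_ _ -> _]]]; rewrite expnM digit_sum_lt. Qed.

End CurveAt.

Unset Implicit Arguments.
Set Strict Implicit.

Theorem theorem3p2 (n : nat) (n_gt1 : 1 < n) (f : nat * nat -> nat)
    (hf : discrete_space_filling_curve n_gt1 f) :
  perfect_pairing_function n f.
Proof.
have [tau [sigma [tau0 sigma0 f0 fE]]] := hf.
(* The hypothesis on f gives the relation only at the exact length of the point; padding carries it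
   to any sufficient positive length, the origin starting from length 1. *)
have f_at k x y : x < n ^ k.+1 -> y < n ^ k.+1 ->
    curve_at n_gt1 tau sigma k.+1 x y (f (x, y)).
  rewrite -!len_leq // => lex ley.
  have [[-> ->]|/eqP xy_neq0] := eqVneq (x, y) (0, 0).
    by rewrite f0; apply: (curve_at_leq tau0 sigma0 _ (curve_at_zero sigma tau0)).
  apply: (curve_at_leq tau0 sigma0 (m := maxn (len n x) (len n y))); last first.
    by case: (fE x y (f (x, y)) xy_neq0) => + _; apply.
  (* Padding starts from a positive length, which holds because the point is not the origin. *)
  rewrite geq_max lex ley !andbT leq_max !ltnNge !len_leq // expn0 !ltnS !leqn0.
  rewrite -negb_and; apply/negP => /andP[/eqP x0 /eqP y0].
  by rewrite x0 y0 in xy_neq0.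
have lt_exp x k : x <= k -> x < n ^ k.+1.
  by move=> le_xk;
     apply: (leq_trans (ltn_expl x n_gt1)); rewrite leq_exp2l // leqW.
split.
  have f_inj : injective f.
    (* By the crude bound [lt_exp], [k.+1] digits suffice for all four coordinates. *)
    move=> [x y] [u v] eq_f; pose k := maxn (maxn x y) (maxn u v).
    have at_xy : curve_at n_gt1 tau sigma k.+1 x y (f (x, y)).
      by apply: f_at; apply: lt_exp; rewrite !leq_max leqnn ?orbT.
    have at_uv : curve_at n_gt1 tau sigma k.+1 u v (f (u, v)).
      by apply: f_at; apply: lt_exp; rewrite !leq_max leqnn ?orbT.
    by rewrite eq_f in at_xy; apply: curve_at_inj at_xy at_uv.
  have f_surj z : exists xy, f xy == z.
    have lt_z : z < (n ^ 2) ^ z.+1.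
      rewrite -expnM; apply: leq_trans (lt_exp z z (leqnn z)) _.
      by rewrite leq_exp2l // leq_pmull.
    have [x [y [ltx lty at_z]]] := curve_at_surj n_gt1 tau sigma lt_z.
    by exists (x, y); apply/eqP; apply: curve_at_fun (f_at _ _ _ ltx lty) at_z.
  have finvK z : f (xchoose (f_surj z)) = z by apply/eqP/(xchooseP (f_surj z)).
  by exists (fun z => xchoose (f_surj z)) => // xy; apply: f_inj.
(* [f_at] needs a positive length; for length 0 both coordinates vanish and [f0] applies. *)
move=> x y [|k]; rewrite !len_leq //.
  by rewrite !ltnS !leqn0 => /eqP-> /eqP->; rewrite f0.
by move=> ltx lty; apply: curve_at_lt (f_at _ _ _ ltx lty).
Qed.
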